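(* Let $X_n\in\mathbb R^{n\times p}$ have i.i.d. entries $X_{ij}=Z_{ij}U_{ij}$, where the variables $U_{ij}$ (supported on $(0,1)$) are i.i.d. with distribution function $$F(u)=\frac1{\log(e/u)},\qquad u\in(0,1),$$ and the variables $Z_{ij}$ are i.i.d. Rademacher random variables ($P(Z_{ij}=1)=P(Z_{ij}=-1)=\frac12$), independent of the $U_{ij}$. Let $S_n=\frac1nX_n^\top X_n$ and $\Sigma=\mathbb E[S_n]$. Then $$\mathbb E\big[\|S_n^{-1}-\Sigma^{-1}\|_2\big]=\infty$$ for every $n\ge1$ and $p\le n$.
   Context: $\|\cdot\|_2$ is the spectral (operator) norm of a matrix. *)

(* Defs.v *)
From HB Require Import structures.
From mathcomp Require Export all_boot all_order all_algebra.
From mathcomp Require Export all_classical all_reals all_analysis.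
Export numFieldNormedType.Exports.

Set Implicit Arguments.
Unset Strict Implicit.
Unset Printing Implicit Defensive.
Import Order.TTheory GRing.Theory Num.Theory.

Local Open Scope classical_set_scope.
Local Open Scope ring_scope.

Section independence.
Context {d : measure_display} {T : measurableType d} {R : realType}.
Variable P : probability T R.

Definition mutually_independent (I : finType) (Y : I -> {RV P >-> R}) : Prop :=
  forall (J : {set I}) (B : I -> set R), (forall i, measurable (B i)) ->
    P (\bigcap_(i in [set` J]) (Y i @^-1` B i)) =
    (\prod_(i in J) P (Y i @^-1` B i))%E.

Definition identically_distributed (I : finType) (Y : I -> {RV P >-> R}) :
    Prop :=
  forall (i j : I) (B : set R), measurable B ->
    distribution P (Y i) B = distribution P (Y j) B.

Definition iid (I : finType) (Y : I -> {RV P >-> R}) : Prop :=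
  mutually_independent Y /\ identically_distributed Y.

Definition sigma_family (I : finType) (Y : I -> {RV P >-> R}) : set (set T) :=
  <<s \bigcup_(i in [set: I]) preimage_set_system setT (Y i) measurable >>.

(* The families Y and Z are independent of each other, as families; nothing is
   said about independence inside Y or inside Z. *)
Definition independent_families (I K : finType)
    (Y : I -> {RV P >-> R}) (Z : K -> {RV P >-> R}) : Prop :=
  forall A B : set T, sigma_family Y A -> sigma_family Z B ->
    P (A `&` B) = (P A * P B)%E.

Definition rademacher (Z : {RV P >-> R}) : Prop :=
  P (Z @^-1` [set 1]) = (2^-1)%:E /\ P (Z @^-1` [set -1]) = (2^-1)%:E.

(* `fine` is harmless on integrable entries: their expectations are finite. *)
Definition expectation_mx (m k : nat) (A : T -> 'M[R]_(m, k)) : 'M[R]_(m, k) :=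
  \matrix_(i, j) fine ('E_P[fun w => A w i j])%E.

End independence.

Section matrices.
Context {R : realType}.

(* The library norm on matrices is the maximum of the absolute values of the
   entries, so the Euclidean norm is spelled out. *)
Definition norm2 (k : nat) (x : 'cV[R]_k) : R :=
  Num.sqrt (\sum_(i < k) x i 0 ^+ 2).

Definition spectral_norm (m k : nat) (A : 'M[R]_(m, k)) : R :=
  sup [set norm2 (A *m x) | x in [set x : 'cV[R]_k | norm2 x <= 1]].

Definition sample_cov (n p : nat) (X : 'M[R]_(n, p)) : 'M[R]_p :=
  n%:R^-1 *: (X^T *m X).

(* The distribution function 1 / log (e / u); only used for 0 < u < 1. *)
Definition F_log (u : R) : R := (ln (expR 1 / u))^-1.

End matrices.

(* Main.v *)
Require Import Defs.
From mathcomp Require Import measurable_realfun ring lra.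
Import Order.TTheory GRing.Theory Num.Theory.
Local Open Scope classical_set_scope.
Local Open Scope ring_scope.

(** The expectation is infinite because S_n has tiny entries with a
    probability that is only polynomially small in the logarithm of their
    size, and its inverse is then enormous.  Write [F] for the distribution function.  As
    [F (expR (1 - s)) = s^-1], an entry of size about [expR (- s)] occurs with
    probability polynomial in [s^-1]; by independence the whole matrix [X] is
    of that size with probability at least [r ^- (2 n p)], where
    [r = s + 1 + n] ([probability_dominant_box_ge]).  All the entries of [S]
    are then at most [expR (2 - 2 s)], and [invmx S - invmx Sigma] has norm
    at least [expR (2 s - 2) / p - C] with [C] depending only on [Sigma]
    ([spectral_norm_invmx_sub_ge]).  By Markov's inequality the expectation is
    at least [expR (2 s - 2) / p * r ^- (2 n p) - C], which is unbounded in
    [s].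

    Invertibility of [S] is built into the event: the [U i j] are confined to
    intervals ([dominant_box]) for which the first [p] rows of [X] are strictly
    diagonally dominant, so that [X] is injective and its Gram matrix [S] is
    nonsingular.  By the independence of the [U i j], the probability of such a
    box is a finite product.  Only the absolute values of the entries of [X]
    matter, and these are the [U i j] as soon as all signs are 1 or -1, which
    is almost sure. *)

(** * The spectral norm of a difference with an inverse *)

Section euclidean_norm.
Context {R : realType}.

Lemma coord_le_norm2 {k : nat} (x : 'cV[R]_k) (i : 'I_k) : `|x i 0| <= norm2 x.
Proof.
rewrite -sqrtr_sqr ler_sqrt ?sumr_ge0 // => [|j _]; last exact: sqr_ge0.
by rewrite (bigD1 i) //= lerDl sumr_ge0 // => j _; exact: sqr_ge0.
Qed.

Lemma norm2_le_sum {k : nat} (x : 'cV[R]_k) : norm2 x <= \sum_(i < k) `|x i 0|.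
Proof.
have S0 : 0 <= \sum_(i < k) `|x i 0| by exact: sumr_ge0.
rewrite -[leRHS](ger0_norm S0) -sqrtr_sqr ler_sqrt ?sqr_ge0 //.
rewrite expr2 mulr_suml; apply: ler_sum => i _.
rewrite -real_normK ?num_real // expr2; apply: ler_wpM2l => //.
by rewrite (bigD1 i) //= lerDl sumr_ge0.
Qed.

(** This bound makes the supremum that defines the spectral norm a genuine
    one: the supremum of an unbounded set of reals is 0 by convention. *)
Lemma norm2_mulmx_le {m k : nat} (A : 'M[R]_(m, k)) {x : 'cV[R]_k} :
  norm2 x <= 1 -> norm2 (A *m x) <= \sum_(i < m) \sum_(j < k) `|A i j|.
Proof.
move=> x1; apply: (le_trans (norm2_le_sum _)); apply: ler_sum => i _.
rewrite mxE; apply: (le_trans (ler_norm_sum _ _ _)); apply: ler_sum => j _.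
by rewrite normrM ler_piMr // (le_trans (coord_le_norm2 _ _)).
Qed.

Lemma norm2_le_spectral_norm {m k : nat} (A : 'M[R]_(m, k)) {x : 'cV[R]_k} :
  norm2 x <= 1 -> norm2 (A *m x) <= spectral_norm A.
Proof.
move=> x1; apply: ub_le_sup; last by exists x.
by exists (\sum_i \sum_j `|A i j|) => _ [y y1 <-]; exact: norm2_mulmx_le.
Qed.

Lemma spectral_norm_ge0 {m k : nat} (A : 'M[R]_(m, k)) : 0 <= spectral_norm A.
Proof.
apply: le_trans (@norm2_le_spectral_norm _ _ A 0 _); first exact: sqrtr_ge0.
apply: (le_trans (norm2_le_sum _)).
by rewrite big1 // => i _; rewrite mxE normr0.
Qed.

(** A matrix [S] with small entries sends a basis vector [e_j] to a short
    vector, so [invmx S] sends that short vector back to [e_j].  The test vector is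
    [S e_j] scaled into the unit ball; testing the difference itself avoids the
    triangle inequality for the spectral norm. *)
Lemma spectral_norm_invmx_sub_ge {p : nat} {S : 'M[R]_p} (B : 'M[R]_p) {t : R}
    (j : 'I_p) :
  0 < t -> S \in unitmx -> (forall i k, `|S i k| <= t) ->
  (p%:R * t)^-1 - \sum_(k < p) `|B j k| <= spectral_norm (invmx S - B).
Proof.
move=> t0 Su St.
have p0 : 0 < p%:R :> R by rewrite ltr0n (leq_ltn_trans _ (ltn_ord j)).
have pt0 : 0 < p%:R * t by exact: mulr_gt0.
pose x : 'cV[R]_p := (p%:R * t)^-1 *: col j S.
have xE i : `|x i 0| <= p%:R^-1.
  rewrite !mxE normrM ger0_norm ?invr_ge0 ?(ltW pt0) //.
  by rewrite ler_pdivrMl // mulrAC mulfV ?gt_eqF // mul1r.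
have x1 : norm2 x <= 1.
  apply: (le_trans (norm2_le_sum _)).
  apply: (@le_trans _ _ (\sum_(i < p) p%:R^-1)); first exact: ler_sum.
  by rewrite sumr_const card_ord -[_ *+ _]mulr_natr mulVf ?gt_eqF.
apply: le_trans (norm2_le_spectral_norm _ x1).
apply: le_trans (coord_le_norm2 _ j).
have -> : (invmx S - B) *m x = (p%:R * t)^-1 *: delta_mx j 0 - B *m x.
  rewrite mulmxBl; congr (_ - _).
  by rewrite -scalemxAr colE mulmxA mulVmx // mul1mx.
rewrite !mxE !eqxx mulr1.
apply: le_trans (lerB_dist _ _).
rewrite ger0_norm ?invr_ge0 ?(ltW pt0) // lerB //.
apply: (le_trans (ler_norm_sum _ _ _)); apply: ler_sum => k _.
rewrite normrM ler_piMr // (le_trans (xE k)) // invf_le1 //.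
by rewrite ler1n -(ltr0n R).
Qed.

End euclidean_norm.

(** * Invertibility and size of the sample covariance *)

Section sample_covariance.
Context {R : realType}.

(** If [S v = 0], then [X v] has square norm [v^T (X^T X) v = 0]. *)
Lemma sample_cov_unitmx {n p : nat} {X : 'M[R]_(n, p)} :
  (0 < n)%N -> (forall v : 'cV[R]_p, X *m v = 0 -> v = 0) ->
  sample_cov X \in unitmx.
Proof.
move=> n0 Xinj; rewrite -row_free_unit; apply: inj_row_free => v.
rewrite /sample_cov -scalemxAr => /eqP; rewrite scaler_eq0 invr_eq0.
rewrite pnatr_eq0 -leqn0 leqNgt n0 /= mulmxA => /eqP vXX.
apply: trmx_inj; rewrite trmx0; apply: Xinj.
have sq0 : \sum_(i < n) (X *m v^T) i 0 ^+ 2 = 0.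
  transitivity ((v *m X^T *m X *m v^T) 0 0); last by rewrite vXX mul0mx mxE.
  rewrite -mulmxA [RHS]mxE; apply: eq_bigr => i _; rewrite expr2; congr (_ * _).
  by rewrite -{2}(trmxK v) -trmx_mul [RHS]mxE.
apply/matrixP => i c; rewrite ord1 [RHS]mxE; apply/eqP; rewrite -sqrf_eq0.
by rewrite (psumr_eq0P _ sq0) // => j _; exact: sqr_ge0.
Qed.

(** At an index [i] where [`|v i|] is maximal, row [i] of [X v = 0] bounds the
    diagonal term by the off-diagonal ones, against strict dominance. *)
Lemma dominant_mulmx_inj {n p : nat} {X : 'M[R]_(n, p)} (le_pn : (p <= n)%N) :
  (forall i : 'I_p, \sum_(j < p | j != i) `|X (widen_ord le_pn i) j| <
                    `|X (widen_ord le_pn i) i|) ->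
  forall v : 'cV[R]_p, X *m v = 0 -> v = 0.
Proof.
move=> dom v Xv; apply/matrixP => k c; rewrite ord1 {c} [RHS]mxE.
have [i _ vmax] := @arg_maxP _ _ _ k xpredT (fun i => `|v i 0|) isT.
apply/eqP; rewrite -normr_le0; apply: le_trans (vmax k isT) _.
rewrite leNgt; apply/negP => vi0.
have /matrixP /(_ (widen_ord le_pn i) 0) := Xv.
rewrite !mxE (bigD1 i) //= => /eqP; rewrite addr_eq0 => /eqP eqi.
have := dom i; rewrite -(ltr_pM2r vi0) -normrM eqi normrN ltNge => /negP; apply.
apply: (le_trans (ler_norm_sum _ _ _)); rewrite mulr_suml.
by apply: ler_sum => j _; rewrite normrM ler_wpM2l //; exact: vmax.
Qed.

Lemma sample_cov_le {n p : nat} {X : 'M[R]_(n, p)} {u : R} :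
  0 <= u -> (forall i j, `|X i j| <= u) ->
  forall j k, `|sample_cov X j k| <= u ^+ 2.
Proof.
move=> u0 Xu j k; rewrite !mxE normrM ger0_norm ?invr_ge0 //.
have [n0|n0] := posnP n.
  by rewrite (_ : n%:R = 0) ?n0 // invr0 mul0r sqr_ge0.
rewrite mulrC ler_pdivrMr ?ltr0n //; apply: (le_trans (ler_norm_sum _ _ _)).
rewrite mulr_natr -[X in _ *+ X]card_ord -sumr_const; apply: ler_sum => i _.
by rewrite mxE normrM expr2 ler_pM.
Qed.

End sample_covariance.

(** * Expectations and probabilities *)

Section probability.
Context {R : realType} {d : measure_display} {T : measurableType d}.
Variable P : probability T R.

(** Markov's inequality for a function that need not be measurable: the
    simple function [c * \1_A] lies below [f], and the integral of a
    nonnegative function is a supremum over such simple functions.  This spares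
    proving that a spectral norm of an inverse is measurable. *)
Lemma expectation_ge_on {f : T -> R} {A : set T} {c : R} :
  measurable A -> (forall w, 0 <= f w) -> (forall w, A w -> c <= f w) ->
  (c%:E * P A <= 'E_P[f])%E.
Proof.
move=> mA f0 fc; have [c0|c0] := leP 0 c; last first.
  apply: (@le_trans _ _ 0%E); last exact: expectation_ge0.
  by apply: mule_le0_ge0 => //; rewrite lee_fin ltW.
rewrite unlock ge0_integralTE; last by move=> w; rewrite lee_fin.
apply: ereal_sup_ubound; exists (scale_nnsfun (indic_nnsfun R mA) c0).
  move=> w /=; rewrite lee_fin /= mindicE; have [Aw|_] := boolP (w \in A).
    by rewrite mulr1; apply: fc; rewrite inE in Aw.
  by rewrite mulr0.
rewrite -integralT_nnsfun /=.
under eq_integral do rewrite EFinM.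
rewrite ge0_integralZl //; first by rewrite integral_indic // setIT.
  by apply/measurable_EFinP; exact: measurable_indic.
by move=> w _; rewrite lee_fin mindicE.
Qed.

Lemma probability_setI_full {A B : set T} :
  measurable A -> measurable B -> P B = 1%E -> P (A `&` B) = P A.
Proof.
move=> mA mB PB.
have PC : P (~` B) = 0%E by rewrite probability_setC // PB subee.
rewrite -[in RHS](setIT A) -(setUv B) setIUr measureU //.
- rewrite [X in (_ + X)%E](_ : _ = 0%E) ?adde0 //.
  apply/eqP; rewrite -measure_le0 -PC le_measure ?inE //.
  + by apply: measurableI => //; exact: measurableC.
  + exact: measurableC.
- exact: measurableI.
- by apply: measurableI => //; exact: measurableC.
- by rewrite setIACA setICr setI0.
Qed.

Lemma probability_itv_cdf (Y : {RV P >-> R}) (a b : R) : a <= b ->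
  P (Y @^-1` `]a, b]) = (cdf Y b - cdf Y a)%E.
Proof.
move=> ab; rewrite /cdf /distribution /pushforward.
have mY (c : R) : measurable (Y @^-1` `]-oo, c]) by exact: measurable_funPTI.
rewrite (_ : _ @^-1` _ = Y @^-1` `]-oo, b] `\` Y @^-1` `]-oo, a]).
  rewrite measureD ?ltey_eq ?fin_num_measure //.
  suff /setIidPr -> : Y @^-1` `]-oo, a] `<=` Y @^-1` `]-oo, b] by [].
  move=> w /=; rewrite !in_itv /= => Ya; exact: le_trans Ya ab.
apply/seteqP; split => w /=; rewrite !in_itv /= ltNge.
  by case/andP => /negP.
by case=> -> /negP ->.
Qed.

End probability.

(** * The logarithmic law and the growth of the exponential *)

Section log_law.
Context {R : realType} {d : measure_display} {T : measurableType d}.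
Variables (P : probability T R) (Y : {RV P >-> R}).
Hypothesis Y_supp : distribution P Y `]0, 1[ = 1%E.
Hypothesis Y_cdf : forall u : R, 0 < u < 1 -> cdf Y u = (F_log u)%:E.

Lemma F_log_expR (s : R) : F_log (expR (1 - s)) = s^-1.
Proof. by rewrite /F_log -expRN -expRD expRK opprB addrCA subrr addr0. Qed.

Lemma cdf_expR (s : R) : 1 < s -> cdf Y (expR (1 - s)) = (s^-1)%:E.
Proof.
move=> s1; rewrite Y_cdf ?F_log_expR // expR_gt0 /=.
by rewrite expR_lt1 subr_lt0.
Qed.

Lemma probability_log_shell (s : R) : 1 < s ->
  P (Y @^-1` `]expR (1 - (s + 1)), expR (1 - s)]) = ((s * (s + 1))^-1)%:E.
Proof.
move=> s1; rewrite probability_itv_cdf ?ler_expR ?lerB ?lerDl //.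
rewrite !cdf_expR //; last by lra.
by rewrite -EFinB; congr (_%:E); field; apply/andP; split; lra.
Qed.

Lemma probability_log_head (s : R) : 1 < s ->
  P (Y @^-1` `]0, expR (1 - s)]) = (s^-1)%:E.
Proof.
move=> s1; rewrite -cdf_expR // /cdf /distribution /pushforward.
have mY (B : set R) : measurable B -> measurable (Y @^-1` B).
  by move=> mB; exact: measurable_funPTI.
rewrite -(@probability_setI_full _ _ _ P (Y @^-1` `]-oo, expR (1 - s)])
          (Y @^-1` `]0, 1[)) //; try exact: mY.
congr (P _); apply/seteqP; split => w /=; rewrite !in_itv /=.
  case/andP => -> le_Yw; rewrite le_Yw; split=> //=.
  by apply: le_lt_trans le_Yw _; rewrite expR_lt1 subr_lt0.
by case=> -> /andP[-> _].
Qed.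

End log_law.

(** From [expR b = expR (b / k.+1) ^+ k.+1 >= (b / k.+1) ^+ k.+1]: one more
    power than needed, so that the spare factor [b] absorbs [A]. *)
Lemma expn_le_expR_above {R : realType} (a A : R) (k : nat) :
  exists2 r : R, a < r & A * r ^+ k <= expR r.
Proof.
pose b : R := Num.max (Num.max a 0 + 1) (A * k.+1%:R ^+ k.+1).
have [b0 ab Ab] : [/\ 0 < b, a < b & A * k.+1%:R ^+ k.+1 <= b].
  rewrite /b !lt_max !le_max lexx orbT; split=> //.
    by rewrite ltr_wpDl // le_max lexx orbT.
  by rewrite ltr_pwDr // le_max lexx.
exists b => //; have k0 : 0 < k.+1%:R :> R by rewrite ltr0n.
have : (b / k.+1%:R) ^+ k.+1 <= expR b.
  have -> : expR b = expR (b / k.+1%:R) ^+ k.+1.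
    by rewrite -expRM_natl mulrC divfK // lt0r_neq0.
  rewrite lerXn2r ?nnegrE ?expR_ge0 ?divr_ge0 ?(ltW b0) //.
  by apply: le_trans (expR_ge1Dx _); rewrite lerDr.
apply: le_trans.
rewrite expr_div_n ler_pdivlMr ?exprn_gt0 // mulrAC [leRHS]exprS.
by rewrite ler_wpM2r // exprn_ge0 // ltW.
Qed.

(** * Matrices with small, diagonally dominant entries *)

Section small_entries.
Context {R : realType} {n p : nat}.
Hypothesis le_pn : (p <= n)%N.

Let rows_gt0 : 'I_p -> (0 < n)%N.
Proof.
by move=> j; rewrite (leq_trans _ le_pn) // (leq_ltn_trans _ (ltn_ord j)).
Qed.

(** A diagonal interval starts at [expR n >= n] times the end of the
    off-diagonal ones, whence the dominance.  The nonzero endpoints have the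
    form [expR (1 - a)], where the logarithmic distribution function takes the
    value [a^-1]. *)
Definition dominant_box (s : R) (ij : 'I_n * 'I_p) : set R :=
  [set` if ij.1 == ij.2 :> nat then `]expR (1 - (s + 1)), expR (1 - s)]
        else `]0, expR (1 - (s + 1 + n%:R))]].

Lemma measurable_dominant_box (s : R) ij : measurable (dominant_box s ij).
Proof. by rewrite /dominant_box; case: ifP => _; exact: measurable_itv. Qed.

Lemma dominant_box_le {s u : R} {ij} :
  dominant_box s ij u -> 0 < u <= expR (1 - s).
Proof.
rewrite /dominant_box; case: ifP => _ /=; rewrite in_itv /= => /andP[u0 us].
  by rewrite us (lt_trans (expR_gt0 _) u0).
by rewrite u0 (le_trans us) // ler_expR; have := ler0n R n; lra.
Qed.

Lemma dominant_box_mulmx_inj (s : R) (X : 'M[R]_(n, p)) :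
  (forall i j, dominant_box s (i, j) `|X i j|) ->
  forall v : 'cV[R]_p, X *m v = 0 -> v = 0.
Proof.
move=> Xs; apply: (dominant_mulmx_inj le_pn) => i.
have n0 : 0 < n%:R :> R by rewrite ltr0n rows_gt0.
have := Xs (widen_ord le_pn i) i; rewrite /dominant_box /= eqxx in_itv /=.
case/andP => lt_s_Xii _; apply: le_lt_trans lt_s_Xii.
set e := expR (1 - (s + 1)).
apply: (@le_trans _ _ (\sum_(j < p | j != i) e / n%:R)); last first.
  rewrite sumr_const -[_ *+ _]mulr_natr.
  rewrite mulrAC ler_pdivrMr // ler_wpM2l ?expR_ge0 // ler_nat.
  by rewrite (leq_trans (max_card _)) // card_ord.
apply: ler_sum => j ji; have := Xs (widen_ord le_pn i) j.
rewrite /dominant_box /= ifF; last by rewrite eq_sym; exact: negbTE.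
rewrite in_itv /= => /andP[_ /le_trans]; apply.
(* This is n <= expR n, the reason for the extra n in the exponent. *)
rewrite ler_pdivlMr // -ler_pdivlMl ?expR_gt0 // /e -expRN -expRD.
by apply: le_trans (expR_ge1Dx _); lra.
Qed.

Lemma spectral_norm_dominant_box_ge (s : R) (X : 'M[R]_(n, p)) (B : 'M[R]_p)
    (j : 'I_p) :
  (forall i j, dominant_box s (i, j) `|X i j|) ->
  expR (2 * s - 2) / p%:R - \sum_(k < p) `|B j k| <=
    spectral_norm (invmx (sample_cov X) - B).
Proof.
move=> Xs; have n0 := rows_gt0 j.
have -> : expR (2 * s - 2) / p%:R = (p%:R * expR (1 - s) ^+ 2)^-1.
  rewrite -expRM_natl invfM mulrC -expRN; congr (_ * expR _); ring.
apply: spectral_norm_invmx_sub_ge => //.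
- by rewrite exprn_gt0 // expR_gt0.
- by apply: sample_cov_unitmx => //; exact: dominant_box_mulmx_inj Xs.
- apply: sample_cov_le => [|i k]; first exact: expR_ge0.
  by have /andP[] := dominant_box_le (Xs i k).
Qed.

End small_entries.

(** * Probability of the box *)

Section events.
Context {R : realType} {d : measure_display} {T : measurableType d}
  {P : probability T R}.

(** Indexed by [[set: I]], because mutual independence speaks of finite sets of
    indices. *)
Definition everywhere_in {I : finType} (Y : I -> {RV P >-> R})
    (B : I -> set R) : set T :=
  \bigcap_(i in [set` [set: I]%SET]) (Y i @^-1` B i).

Lemma everywhere_inP {I : finType} (Y : I -> {RV P >-> R}) B w :
  everywhere_in Y B w <-> forall i, B i (Y i w).
Proof. by split=> [YB i|YB i _]; [apply: YB; rewrite /= inE|exact: YB]. Qed.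

Lemma measurable_everywhere_in {I : finType} (Y : I -> {RV P >-> R}) B :
  (forall i, measurable (B i)) -> measurable (everywhere_in Y B).
Proof.
move=> mB; apply: fin_bigcap_measurable => [|i _]; first exact: finite_finset.
exact: measurable_funPTI.
Qed.

Lemma probability_everywhere_in {I : finType} (Y : I -> {RV P >-> R}) B :
  mutually_independent Y -> (forall i, measurable (B i)) ->
  P (everywhere_in Y B) = (\prod_i P (Y i @^-1` B i))%E.
Proof.
move=> Yind mB; rewrite /everywhere_in Yind //.
by apply: eq_bigl => i; rewrite inE.
Qed.

Lemma rademacher_sign (Z : {RV P >-> R}) :
  rademacher Z -> P (Z @^-1` [set 1; -1]) = 1%E.
Proof.
case=> Z1 ZN1; rewrite preimage_setU measureU.
- by rewrite [X in (X + _)%E]Z1 [X in (_ + X)%E]ZN1 -EFinD; congr (_%:E); lra.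
- exact: measurable_funPTI.
- exact: measurable_funPTI.
- apply/seteqP; split=> w //= -[-> ] /eqP; rewrite -subr_eq0 opprK.
  by rewrite (_ : 1 + 1 = 2%:R) // pnatr_eq0.
Qed.

(** Every factor of the product is at least [(s + 1 + n) ^- 2]: the diagonal
    ones are [(s * (s + 1))^-1], the others [(s + 1 + n)^-1]. *)
Lemma probability_dominant_box_ge {n p : nat} (U : 'I_n * 'I_p -> {RV P >-> R})
    (s : R) :
  1 < s -> mutually_independent U ->
  (forall ij, distribution P (U ij) `]0, 1[ = 1%E) ->
  (forall ij (u : R), 0 < u < 1 -> cdf (U ij) u = (F_log u)%:E) ->
  (((s + 1 + n%:R) ^- (2 * (n * p)))%:E <=
    P (everywhere_in U (dominant_box s)))%E.
Proof.
move=> s1 Uind Usupp Ucdf; have n0 := ler0n R n.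
rewrite probability_everywhere_in //; last exact: measurable_dominant_box.
pose q (ij : 'I_n * 'I_p) :=
  if ij.1 == ij.2 :> nat then (s * (s + 1))^-1 else (s + 1 + n%:R)^-1.
rewrite (eq_bigr (fun ij => (q ij)%:E)) => [|ij _]; last first.
  rewrite /dominant_box /q; case: ifP => _.
    exact: (probability_log_shell _ _ (Ucdf ij)).
  by apply: (probability_log_head _ _ (Usupp ij) (Ucdf ij)); lra.
rewrite prodEFin lee_fin.
have -> : (s + 1 + n%:R) ^- (2 * (n * p)) =
          \prod_(ij : 'I_n * 'I_p) (s + 1 + n%:R) ^- 2.
  by rewrite prodr_const card_prod !card_ord -exprVn exprM exprVn.
apply: ler_prod => ij _; rewrite invr_ge0 exprn_ge0 /=; last by lra.
rewrite /q; case: ifP => _; rewrite lef_pV2 ?posrE; nra.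
Qed.

End events.

(* invmx A is A itself for singular A; here the sample matrix S w is almost
   surely invertible (the U i j have no atoms and p <= n), so this convention
   only affects a null set. *)
Theorem proposition4p2 (R : realType) (d : measure_display)
    (T : measurableType d) (P : probability T R) (n p : nat)
    (U Z : 'I_n -> 'I_p -> {RV P >-> R})
    (n_ge1 : (1 <= n)%N) (p_ge1 : (1 <= p)%N) (p_le_n : (p <= n)%N)
    (U_iid : iid (fun ij : 'I_n * 'I_p => U ij.1 ij.2))
    (U_supp : forall i j, distribution P (U i j) `]0, 1[ = 1%E)
    (U_cdf : forall i j (u : R), 0 < u < 1 -> cdf (U i j) u = (F_log u)%:E)
    (Z_iid : iid (fun ij : 'I_n * 'I_p => Z ij.1 ij.2))
    (Z_rademacher : forall i j, rademacher (Z i j))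
    (UZ_indep : independent_families (fun ij : 'I_n * 'I_p => U ij.1 ij.2)
                                     (fun ij : 'I_n * 'I_p => Z ij.1 ij.2)) :
  let X := fun w : T => \matrix_(i < n, j < p) (Z i j w * U i j w) in
  let S := fun w : T => sample_cov (X w) in
  let Sigma := expectation_mx P S in
  ('E_P[fun w => spectral_norm (invmx (S w) - invmx Sigma)])%E = +oo%E.
Proof.
move=> X S Sigma.
pose Us ij := U ij.1 ij.2; pose Zs ij := Z ij.1 ij.2.
have j0 : 'I_p by exact: Ordinal p_ge1.
pose C := \sum_(k < p) `|invmx Sigma j0 k|.
have C0 : 0 <= C by exact: sumr_ge0.
pose sign_set (ij : 'I_n * 'I_p) : set R := [set 1; -1].
pose E s := everywhere_in Us (dominant_box s) `&` everywhere_in Zs sign_set.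
have mU s : measurable (everywhere_in Us (dominant_box s)).
  apply: measurable_everywhere_in; exact: measurable_dominant_box.
have mZ : measurable (everywhere_in Zs sign_set).
  by apply: measurable_everywhere_in => ij; exact: measurableU.
have PE s : P (E s) = P (everywhere_in Us (dominant_box s)).
  apply: probability_setI_full => //.
  rewrite probability_everywhere_in; [|exact: Z_iid.1|].
    by rewrite big1 // => ij _; exact: (rademacher_sign _ (Z_rademacher _ _)).
  by move=> ij; exact: measurableU.
have norm_ge s w : E s w ->
    expR (2 * s - 2) / p%:R - C <= spectral_norm (invmx (S w) - invmx Sigma).
  move=> [/everywhere_inP Uw /everywhere_inP Zw].
  apply: spectral_norm_dominant_box_ge => // i j.
  have -> : `|X w i j| = U i j w; last exact: (Uw (i, j)).
  have /andP[/ltW Uij0 _] := dominant_box_le (Uw (i, j)).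
  rewrite mxE normrM (ger0_norm Uij0).
  by case: (Zw (i, j)) => /= ->; rewrite ?normrN normr1 mul1r.
apply/eqyP => M M0.
(* With r = s + 1 + n, the threshold on r is what gives r <= 2 * s - 2. *)
have [r r_gt r_exp] :=
  expn_le_expR_above (2 * n%:R + 4) (p%:R * (M + C)) (2 * (n * p)).
have n0 := ler0n R n.
pose s := r - 1 - n%:R.
have s1 : 1 < s by rewrite /s; lra.
have r0 : 0 < r by lra.
have p0 : 0 < p%:R :> R by rewrite ltr0n.
have mE : measurable (E s) by exact: measurableI.
apply: (le_trans _ (expectation_ge_on P mE _ (norm_ge s))); last first.
  by move=> w; exact: spectral_norm_ge0.
have := probability_dominant_box_ge Us s s1 U_iid.1 (fun ij => U_supp ij.1 ij.2)
  (fun ij => U_cdf ij.1 ij.2).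
rewrite -/Us -PE (_ : s + 1 + n%:R = r); last by rewrite /s; lra.
have := probability_le1 P mE.
have : P (E s) \is a fin_num by rewrite fin_num_measure.
move=> /fineK <-; move: (fine _) => q; rewrite !lee_fin => q1 q_ge.
have exp_ge : (M + C) * r ^+ (2 * (n * p)) <= expR (2 * s - 2) / p%:R.
  rewrite ler_pdivlMr // mulrAC [_ * p%:R]mulrC; apply: (le_trans r_exp).
  by rewrite ler_expR /s; lra.
have rK : 0 < r ^+ (2 * (n * p)) by exact: exprn_gt0.
have q0 : 0 <= q by apply: le_trans q_ge; rewrite invr_ge0 ltW.
(* The probability q multiplies C too, but q <= 1, so C is all that is lost. *)
have MC_le : M + C <= expR (2 * s - 2) / p%:R * q.
  apply: (@le_trans _ _ ((M + C) * r ^+ (2 * (n * p)) * q)).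
    rewrite -mulrA ler_peMr ?addr_ge0 ?(ltW M0) //.
    by rewrite -ler_pdivrMl // mulr1.
  exact: ler_wpM2r.
rewrite mulrBl lerBrDr; apply: le_trans MC_le; rewrite lerD2l.
by rewrite ler_piMr.
Qed.
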